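(* (Minimum-energy control for linear ensemble systems.) Let $X_0(\beta_i), X_F(\beta_i)\in\mathbb{R}^n$, $i=1,\ldots,N$, be initial and target states of the sampled linear ensemble system $$\frac{d}{dt}X(t,\beta_i)=A(t,\beta_i)X(t,\beta_i)+B(t,\beta_i)u(t),\qquad i=1,\ldots,N,\ t\in[0,T],$$ where each individual system (indexed by $\beta_i$) is controllable on $[0,T]$. Let $C_i=\{u\in L^2([0,T],\mathbb{R}^m): L_iu=\xi_i\}$ and let $\lambda_i\in(0,1)$ satisfy $\sum_{i=1}^N\lambda_i=1$. If $\bigcap_{i=1}^N C_i\neq\emptyset$, then the control sequence $\{u^{(k)}\}$ with $u^{(0)}=0\in L^2([0,T],\mathbb{R}^m)$ generated by $$u^{(k+1)}=\Big(I_d-\sum_{i=1}^N\lambda_i L_i^*(L_iL_i^* )^{-1}L_i\Big)u^{(k)}+\sum_{i=1}^N\lambda_i L_i^*(L_iL_i^* )^{-1}\xi_i,\qquad k=0,1,2,\ldots,$$ converges in norm to the minimum-energy ensemble control that steers the ensemble from $X_0(\beta_i)$ to $X_F(\beta_i)$, $i=1,\ldots,N$.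
   Context: Setting: $T\in(0,\infty)$ is fixed; $\beta_1,\ldots,\beta_N$ are parameter values in a compact set $K\subset\mathbb{R}$; for each $i$, $A(\cdot,\beta_i)\in L^\infty([0,T],\mathbb{R}^{n\times n})$ and $B(\cdot,\beta_i)\in L^2([0,T],\mathbb{R}^{n\times m})$; the same control $u\in L^2([0,T],\mathbb{R}^m)$ is applied to all $N$ systems, and $X(t,\beta_i)\in\mathbb{R}^n$. $\Phi(t,s,\beta_i)$ is the transition matrix of the $i$-th system: $\frac{\partial}{\partial t}\Phi(t,s,\beta_i)=A(t,\beta_i)\Phi(t,s,\beta_i)$ (for a.e. $t$), $\Phi(s,s,\beta_i)=I$. The bounded linear operator $L_i:L^2([0,T],\mathbb{R}^m)\to\mathbb{R}^n$ is $L_i(u)=\int_0^T\Phi(T,\sigma,\beta_i)B(\sigma,\beta_i)u(\sigma)\,d\sigma$, $L_i^*$ is its adjoint, and $\xi_i=X_F(\beta_i)-\Phi(T,0,\beta_i)X_0(\beta_i)\in\mathbb{R}^n$. $I_d$ is the identity operator on $L^2([0,T],\mathbb{R}^m)$. Controllability of the $i$-th system means that $L_i$ has range $\mathbb{R}^n$, equivalently that $L_iL_i^*$ is invertible. A control $u$ steers the ensemble from $X_0(\beta_i)$ to $X_F(\beta_i)$ at time $T$ for all $i$ exactly when $u\in\bigcap_{i=1}^N C_i$. The minimum-energy ensemble control is the minimizer of $\|u\|_2^2=\int_0^T u(t)'u(t)\,dt$ over $u\in\bigcap_{i=1}^N C_i$. *)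

(* Defs.v *)
From HB Require Import structures.
From mathcomp Require Import all_boot all_order all_algebra.
From mathcomp Require Import all_classical all_reals all_analysis.

Set Implicit Arguments.
Unset Strict Implicit.
Unset Printing Implicit Defensive.

Import Order.TTheory GRing.Theory Num.Theory.
Import numFieldNormedType.Exports.

Local Open Scope classical_set_scope.
Local Open Scope ring_scope.

(* Elements of L^p([0,T], R^{a x b}) are represented by functions on the whole
   line whose entries, cut off outside [0,T], are in the library's L^p; the
   values outside [0,T] are irrelevant. Two functions stand for the same
   element when they agree almost everywhere on [0,T]. *)
Definition Lp {R : realType} (p : \bar R) (T : R) {a b : nat}
    (f : R -> 'M[R]_(a, b)) : Prop :=
  forall i j,
    ((fun t => f t i j) \_ `[0, T]) \in Lfun (@lebesgue_measure R) p.

Definition dotv {R : realType} {n : nat} (x y : 'cV[R]_n) : R :=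
  (x^T *m y) 0 0.

Definition L2dot {R : realType} (T : R) {m : nat} (u v : R -> 'cV[R]_m) : R :=
  \int[lebesgue_measure]_(t in `[0, T]) dotv (u t) (v t).

Definition L2norm {R : realType} (T : R) {m : nat} (u : R -> 'cV[R]_m) : R :=
  Num.sqrt (L2dot T u u).

Definition abs_continuous {R : realType} (a b : R) (f : R -> R) : Prop :=
  forall e : R, 0 < e -> exists2 d : R, 0 < d &
    forall (k : nat) (x y : 'I_k -> R),
      (forall i, a <= x i /\ x i <= y i /\ y i <= b) ->
      (forall i j, i != j -> y i <= x j \/ y j <= x i) ->
      \sum_(i < k) (y i - x i) < d ->
      \sum_(i < k) `|f (y i) - f (x i)| < e.

(* As A is only essentially bounded, the matrix differential equation is
   understood in the sense of Caratheodory: Phi(., s) is absolutely continuous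
   on [0,T] and satisfies it almost everywhere. *)
Definition transition_matrix {R : realType} (T : R) {n : nat}
    (A : R -> 'M[R]_n) (Phi : R -> R -> 'M[R]_n) : Prop :=
  forall s, s \in `[0, T] ->
    [/\ Phi s s = 1%:M,
        forall i j, abs_continuous 0 T (fun t => Phi t s i j)
      & {ae lebesgue_measure, forall t, t \in `]0, T[ ->
          forall i j, is_derive t (1 : R) (fun t => Phi t s i j)
                        ((A t *m Phi t s) i j)}].

Definition control_op {R : realType} (T : R) {n m : nat}
    (Phi : R -> R -> 'M[R]_n) (B : R -> 'M[R]_(n, m)) (u : R -> 'cV[R]_m) :
    'cV[R]_n :=
  \col_k \int[lebesgue_measure]_(s in `[0, T])
           ((Phi T s *m B s *m u s) k 0).

(* The Hilbert space adjoint: [adjoint T L x] is a chosen representative of the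
   element v of L^2([0,T], R^m), unique up to almost everywhere equality, such
   that <u, v> = <L u, x> for all u. When there is no such v, which does not
   happen for a bounded linear L, it is the zero function. *)
Definition adjoint {R : realType} (T : R) {n m : nat}
    (L : (R -> 'cV[R]_m) -> 'cV[R]_n) (x : 'cV[R]_n) : R -> 'cV[R]_m :=
  xget 0 [set v | Lp 2%:E T v /\
                  forall u, Lp 2%:E T u -> L2dot T u v = dotv (L u) x].

(* Inverse of the map f; zero is the value at points outside its range. *)
Definition inv_map {R : realType} {n : nat} (f : 'cV[R]_n -> 'cV[R]_n) :
    'cV[R]_n -> 'cV[R]_n :=
  'pinv_(fun=> 0) [set: 'cV[R]_n] f.

Definition controllable {R : realType} (T : R) {n m : nat}
    (L : (R -> 'cV[R]_m) -> 'cV[R]_n) : Prop :=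
  forall x, exists2 u, Lp 2%:E T u & L u = x.

Definition steering_set {R : realType} (T : R) {n m : nat}
    (L : (R -> 'cV[R]_m) -> 'cV[R]_n) (xi : 'cV[R]_n) : set (R -> 'cV[R]_m) :=
  [set u | Lp 2%:E T u /\ L u = xi].

Definition is_min_energy {R : realType} (T : R) {m : nat}
    (C : set (R -> 'cV[R]_m)) (u : R -> 'cV[R]_m) : Prop :=
  C u /\ forall v, C v -> L2norm T u ^+ 2 <= L2norm T v ^+ 2.

(* Main.v *)
Require Import Defs.
From HB Require Import structures.
From mathcomp Require Import all_boot all_order all_algebra.
From mathcomp Require Import all_classical all_reals all_analysis.
From mathcomp Require Import measurable_realfun ess_sup_inf.
From mathcomp Require Import ring lra.

(** Write [<u, v>] for the inner product of L^2([0,T], R^m). The component [k] of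
    [L_i u] is [<u, g_i,k>], where [g_i,k] is row [k] of [Phi_i(T, .) B_i]; the
    range of the adjoint of [L_i] is therefore the span [V_i] of the [g_i,k], and
    [L_i^* (L_i L_i^* )^-1 L_i] is the orthogonal projection [P_i] on [V_i].

    The minimum-energy control [us] is the orthogonal projection of any feasible
    control on [V = sum_i V_i]: the projection does not change the numbers
    [<u, g_i,k>], so it is feasible, and two feasible controls differ by an
    element orthogonal to [V], so the theorem of Pythagoras gives both minimality
    and uniqueness.

    Since [L_i us = xi_i], the error [e_k = u_k - us] satisfies
    [e_(k+1) = e_k - sum_i lambda_i P_i e_k], and it stays in [V] because the
    iteration starts at zero. With [q = sum_i lambda_i |P_i e|^2], convexity of
    the squared norm gives [|e - sum_i lambda_i P_i e|^2 <= |e|^2 - q]. On the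
    finite-dimensional space [V] the norm is controlled by the inner products
    with the spanning family ([frame_lower_bound]), and [<e, g_i,k>] equals
    [<P_i e, g_i,k>], so [|e|^2 <= E q] for a constant [E]. Each step thus
    multiplies [|e|^2] by at most [1 - 1/E]
    ([averaged_projections_contract]).

    The functions [g_i,k] are square integrable only if [Phi(T, .)] is measurable
    and bounded, whereas the definition of a transition matrix speaks of
    [Phi(., s)] for each fixed [s]. The link is the cocycle identity
    [Phi(t,s) Phi(s,0) = Phi(t,0)] ([transition_matrix_cocycle]), which makes
    [Phi(T,s) = Phi(T,0) Phi(s,0)^-1] continuous in [s]. The identity is a
    uniqueness statement for Caratheodory solutions of a linear equation, and it
    rests on the fact that an absolutely continuous function whose derivative is
    bounded by [M] almost everywhere is [M]-Lipschitz
    ([abs_continuous_lipschitz]). *)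

Set Implicit Arguments.
Unset Strict Implicit.
Unset Printing Implicit Defensive.

Import Order.TTheory GRing.Theory Num.Theory.
Import numFieldNormedType.Exports.

Local Open Scope classical_set_scope.
Local Open Scope ring_scope.

(** * Positive semidefinite forms and averaged projections *)

(** Any matrix [G], indexed here by an arbitrary finite type, has some [P] with
    [G P G = G]. For a possibly singular Gram matrix this replaces the inverse in
    both lemmas on finite families below. *)
Lemma generalized_inverse (F : fieldType) (I : finType) (G : I -> I -> F) :
  exists P : I -> I -> F, forall p q,
    \sum_r \sum_s G p r * P r s * G s q = G p q.
Proof.
pose W := \matrix_(i < #|I|, j < #|I|) G (enum_val i) (enum_val j).
exists (fun r s => pinvmx W (enum_rank r) (enum_rank s)) => p q.
have /matrixP/(_ (enum_rank p) (enum_rank q)) := mulmxKpV (submx_refl W).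
rewrite !mxE !enum_rankK => <-.
rewrite exchange_big /= (reindex (@enum_val I I)) /=; last first.
  by apply: onW_bij; exact: enum_val_bij.
apply: eq_bigr => i _.
rewrite mxE big_distrl /= (reindex (@enum_val I I)) /=; last first.
  by apply: onW_bij; exact: enum_val_bij.
by apply: eq_bigr => j _; rewrite !mxE !enum_rankK !enum_valK.
Qed.

Section SemiInner.
Context {R : realType} {V : lmodType R}.

(** The form is only semidefinite and lives on a subset [S] of [V], because
    square-integrable functions are not identified when they agree almost
    everywhere: [dot] is meaningless outside [S], and nonzero elements of [S] may
    have norm zero. *)
Record semi_inner (S : set V) (dot : V -> V -> R) : Prop := SemiInner {
  si_0 : S 0;
  si_D : forall u v, S u -> S v -> S (u + v);
  si_Z : forall c u, S u -> S (c *: u);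
  si_C : forall u v, S u -> S v -> dot u v = dot v u;
  si_dotD : forall u v w, S u -> S v -> S w -> dot (u + v) w = dot u w + dot v w;
  si_dotZ : forall c u w, S u -> S w -> dot (c *: u) w = c * dot u w;
  si_ge0 : forall u, S u -> 0 <= dot u u }.

Variables (S : set V) (dot : V -> V -> R) (H : semi_inner S dot).

Let S0 := si_0 H.
Let SD := si_D H.
Let SZ := si_Z H.

Lemma si_N u : S u -> S (- u).
Proof. by rewrite -scaleN1r; exact: SZ. Qed.

Lemma si_B u v : S u -> S v -> S (u - v).
Proof. by move=> Su Sv; apply: SD => //; exact: si_N. Qed.

Lemma si_sum (I : finType) (c : I -> R) (g : I -> V) :
  (forall p, S (g p)) -> S (\sum_p c p *: g p).
Proof. by move=> Sg; apply: big_ind => // i _; exact: SZ. Qed.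

Lemma si_dotDr u v w : S u -> S v -> S w -> dot w (u + v) = dot w u + dot w v.
Proof.
by move=> Su Sv Sw; rewrite !(si_C H Sw)// ?(si_dotD H)//; exact: SD.
Qed.

Lemma si_dotZr c u w : S u -> S w -> dot w (c *: u) = c * dot w u.
Proof.
by move=> Su Sw; rewrite !(si_C H Sw)// ?(si_dotZ H)//; exact: SZ.
Qed.

Lemma si_dotBl u v w : S u -> S v -> S w -> dot (u - v) w = dot u w - dot v w.
Proof.
move=> Su Sv Sw; rewrite (si_dotD H)//; last exact: si_N.
by rewrite -scaleN1r (si_dotZ H)// mulN1r.
Qed.

Lemma si_dotBr u v w : S u -> S v -> S w -> dot w (u - v) = dot w u - dot w v.
Proof.
by move=> Su Sv Sw; rewrite !(si_C H Sw)// ?si_dotBl//; exact: si_B.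
Qed.

Lemma si_dot_suml (I : finType) (c : I -> R) (g : I -> V) w :
  (forall p, S (g p)) -> S w ->
  dot (\sum_p c p *: g p) w = \sum_p c p * dot (g p) w.
Proof.
move=> Sg Sw.
suff [] : S (\sum_p c p *: g p) /\
  dot (\sum_p c p *: g p) w = \sum_p c p * dot (g p) w by [].
apply: (big_ind2 (fun x y => S x /\ dot x w = y)).
- by split=> //; rewrite -(scale0r 0) (si_dotZ H)// mul0r.
- by move=> x a y b [Sx <-] [Sy <-]; split; [exact: SD|rewrite (si_dotD H)].
- by move=> p _; split; [exact: SZ|rewrite (si_dotZ H)].
Qed.

Lemma si_dot_sumr (I : finType) (c : I -> R) (g : I -> V) w :
  (forall p, S (g p)) -> S w ->
  dot w (\sum_p c p *: g p) = \sum_p c p * dot w (g p).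
Proof.
move=> Sg Sw; rewrite (si_C H Sw) ?si_dot_suml//; last exact: si_sum.
by apply: eq_bigr => p _; rewrite (si_C H Sw).
Qed.

Lemma si_expandB u v : S u -> S v ->
  dot (u - v) (u - v) = dot u u - 2 * dot u v + dot v v.
Proof.
move=> Su Sv; have Suv := si_B Su Sv.
by rewrite si_dotBl// !si_dotBr// (si_C H Sv Su); ring.
Qed.

Lemma si_cauchy_schwarz u v : S u -> S v ->
  dot u v ^+ 2 <= dot u u * dot v v.
Proof.
move=> Su Sv.
have key a c : 0 <= a ^+ 2 * dot u u - 2 * (a * c * dot u v) + c ^+ 2 * dot v v.
  have := si_ge0 H (si_B (SZ a Su) (SZ c Sv)).
  rewrite si_expandB; [|exact: SZ..].
  rewrite !(si_dotZ H)//; try exact: SZ.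
  by rewrite !si_dotZr//; congr (_ <= _); ring.
have := si_ge0 H Sv; rewrite le_eqVlt => /orP[/eqP v0|v0].
  rewrite -v0 mulr0; have [->|uv0] := eqVneq (dot u v) 0; first by rewrite expr0n.
  (* otherwise a suitable c makes the form negative at u - c v *)
  have := key 1 ((dot u u + 1) / dot u v); rewrite -v0 mulr0 addr0 expr1n !mul1r.
  rewrite mulfVK//; have := si_ge0 H Su; lra.
rewrite -subr_ge0 -(pmulr_rge0 _ v0); have := key (dot v v) (dot u v).
have -> : dot v v ^+ 2 * dot u u - 2 * (dot v v * dot u v * dot u v) +
   dot u v ^+ 2 * dot v v = dot v v * (dot u u * dot v v - dot u v ^+ 2) by ring.
by [].
Qed.

Lemma si_null u v : S u -> S v -> dot v v = 0 -> dot u v = 0.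
Proof.
move=> Su Sv v0; have := si_cauchy_schwarz Su Sv.
by rewrite v0 mulr0 => h; apply/eqP; rewrite -sqrf_eq0 eq_le h sqr_ge0.
Qed.

Section Family.
Variables (I : finType) (g : I -> V) (Sg : forall p, S (g p)).

(** Orthogonal projection of [w] on the span of a finite family. With [G] the
    Gram matrix, [G P G = G] and [b p = dot (g p) w], the coefficients are [P b].
    That [G P b = b] holds because each row of [1 - G P] is the coefficient
    vector of a combination [v] orthogonal to the whole family, hence of norm
    zero, hence orthogonal to [w] too. *)
Lemma normal_equations w : S w ->
  exists x : I -> R, forall p, dot (g p) (\sum_q x q *: g q) = dot (g p) w.
Proof.
move=> Sw; pose G p q := dot (g p) (g q).
have [P PE] := generalized_inverse G.
exists (fun r => \sum_s P r s * dot (g s) w) => p.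
pose z q := (q == p)%:R - \sum_r G p r * P r q.
pose v := \sum_q z q *: g q.
have Sv : S v by exact: si_sum.
have gz p' : dot v (g p') = 0.
  rewrite /v si_dot_suml//.
  under eq_bigr do rewrite mulrBl big_distrl /=.
  rewrite sumrB exchange_big /= PE (bigD1 p)//= eqxx mul1r big1 ?addr0 ?subrr//.
  by move=> q /negbTE ->; rewrite mul0r.
have v0 : dot v v = 0.
  by rewrite {2}/v si_dot_sumr// big1// => q _; rewrite gz mulr0.
have : dot v w = 0 by rewrite (si_C H)//; exact: si_null.
rewrite /v si_dot_suml// => /esym/eqP.
under eq_bigr do rewrite mulrBl.
rewrite sumrB eq_sym subr_eq0 (bigD1 p)//= eqxx mul1r big1 ?addr0; last first.
  by move=> q /negbTE ->; rewrite mul0r.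
move=> /eqP ->; rewrite si_dot_sumr//.
under eq_bigr do rewrite big_distrl /=.
under [LHS]eq_bigr do rewrite big_distrl /=.
rewrite exchange_big /=; apply: eq_bigr => q _; apply: eq_bigr => r _.
by rewrite /G; ring.
Qed.

(** If [v] has coefficients [x] then [y = G x] lists the [dot v (g p)], and
    [dot v v = x^T G x = x^T G P G x = y^T P y], which the entries of [P] bound
    by a multiple of [|y|^2]. The vector [v] only needs to have the same inner
    products as a combination of the family, so that representatives that differ
    by a null vector are covered. *)
Lemma frame_lower_bound : exists2 C : R, 0 <= C & forall v (x : I -> R),
  S v -> (forall w, S w -> dot w v = \sum_q x q * dot w (g q)) ->
  dot v v <= C * \sum_p dot v (g p) ^+ 2.
Proof.
pose G p q := dot (g p) (g q).
have [P PE] := generalized_inverse G.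
exists (\sum_r \sum_s `|P r s|) => [|v x Sv vx].
  by apply: sumr_ge0 => r _; apply: sumr_ge0.
pose y p := dot v (g p).
have yE p : y p = \sum_q x q * G p q by rewrite /y (si_C H)// vx.
have -> : dot v v = \sum_r \sum_s y r * P r s * y s.
  rewrite vx//.
  transitivity (\sum_q \sum_p x q * x p * G q p).
    apply: eq_bigr => q _; rewrite -/(y q) yE mulr_sumr.
    by apply: eq_bigr => p _; rewrite mulrA.
  transitivity (\sum_q \sum_p \sum_r \sum_s x q * G q r * P r s * (x p * G s p)).
    apply: eq_bigr => q _; apply: eq_bigr => p _; rewrite -PE mulr_sumr.
    apply: eq_bigr => r _; rewrite mulr_sumr.
    by apply: eq_bigr => s _; ring.
  rewrite pair_big_dep /= exchange_big /=; apply: eq_bigr => r _.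
  rewrite exchange_big /=; apply: eq_bigr => s _.
  rewrite !yE mulr_suml mulr_suml -(pair_big xpredT xpredT
    (fun q p => x q * G q r * P r s * (x p * G s p))) /=.
  apply: eq_bigr => q _; rewrite mulr_sumr.
  by apply: eq_bigr => p _; rewrite /G (si_C H (Sg r)).
rewrite big_distrl /=; apply: ler_sum => r _.
rewrite big_distrl /=; apply: ler_sum => s _.
have le_y t : y t ^+ 2 <= \sum_p y p ^+ 2.
  by rewrite (bigD1 t)//= lerDl; apply: sumr_ge0 => p _; exact: sqr_ge0.
rewrite (le_trans (ler_norm _))// !normrM mulrAC mulrC ler_wpM2l//.
have := le_y r; have := le_y s; rewrite -(real_normK (num_real (y s))).
rewrite -(real_normK (num_real (y r))).
move: (\sum_p _) `|y r| `|y s| (normr_ge0 (y r)) (normr_ge0 (y s)) => Y a b.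
by have := sqr_ge0 (a - b); nra.
Qed.

End Family.

(** Here [P i] is, up to null vectors, the orthogonal projection of [v] on the
    span of the [g i p], and [v] lies in the sum of these spans. Put
    [e = sum_i lambda_i |P i|^2]. Convexity gives [|v'|^2 <= |v|^2 - e], while
    [frame_lower_bound] and the Cauchy-Schwarz inequality for
    [dot v (g i p) = dot (P i) (g i p)] give [|v|^2 <= E e]. *)
Lemma averaged_projections_contract (J I : finType) (g : J -> I -> V)
    (lambda : J -> R) :
  (forall i p, S (g i p)) -> (forall i, 0 < lambda i) -> \sum_i lambda i = 1 ->
  exists2 rho : R, 0 <= rho < 1 &
  forall (v : V) (x : J -> I -> R) (P : J -> V),
    S v -> (forall w, S w -> dot w v = \sum_i \sum_p x i p * dot w (g i p)) ->
    (forall i, S (P i)) ->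
    (forall i p, dot (P i) (g i p) = dot v (g i p)) ->
    (forall i, dot v (P i) = dot (P i) (P i)) ->
  let v' := v - \sum_i lambda i *: P i in dot v' v' <= rho * dot v v.
Proof.
move=> Sg l0 l1.
have [C C0 frame] := @frame_lower_bound _ (fun ip : J * I => g ip.1 ip.2)
  (fun ip => Sg ip.1 ip.2).
pose D := \sum_i \sum_p dot (g i p) (g i p) / lambda i.
have D0 i : 0 <= \sum_p dot (g i p) (g i p) / lambda i.
  apply: sumr_ge0 => p _; apply: divr_ge0; last exact: ltW.
  exact: (si_ge0 H).
(* C comes from the frame bound, D from Cauchy-Schwarz; adding 1 makes E >= 1 *)
pose E := C * D + 1.
have E1 : 1 <= E by rewrite lerDr mulr_ge0// sumr_ge0.
have E0 : 0 < E by exact: lt_le_trans E1.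
exists (1 - E^-1) => [|v x P Sv vx SP Pg PP] /=.
  by rewrite subr_ge0 invf_le1// E1/= ltrBlDr ltrDl invr_gt0.
pose e := \sum_i lambda i * dot (P i) (P i).
have e0 : 0 <= e.
  apply: sumr_ge0 => i _; apply: mulr_ge0; first exact: ltW.
  exact: (si_ge0 H).
have ve : dot v v <= E * e.
  have /= := frame v (fun ip => x ip.1 ip.2) Sv.
  move=> /(_ _)/le_trans; apply.
    by move=> w Sw; rewrite vx// pair_big.
  rewrite -(pair_big xpredT xpredT (fun i p => dot v (g i p) ^+ 2)) /=.
  apply: (@le_trans _ _ (C * (D * e))); last first.
    by rewrite mulrA ler_wpM2r// lerDl.
  apply: ler_wpM2l => //; rewrite big_distrl /=; apply: ler_sum => i _.
  rewrite big_distrl /=; apply: ler_sum => p _.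
  rewrite -Pg; apply: le_trans (si_cauchy_schwarz (SP i) (Sg i p)) _.
  rewrite mulrC -mulrA; apply: ler_wpM2l; first exact: (si_ge0 H).
  rewrite mulrC ler_pdivlMr// mulrC /e (bigD1 i)//= lerDl.
  apply: sumr_ge0 => j _; apply: mulr_ge0; first exact: ltW.
  exact: (si_ge0 H).
pose m := \sum_i lambda i *: P i.
have Sm : S m by exact: si_sum.
have vm : dot v m = e.
  by rewrite si_dot_sumr//; apply: eq_bigr => i _; rewrite PP.
have mm : dot m m <= e.
  (* e - |m|^2 is the weighted variance of the P i *)
  have -> : e = e - 2 * dot m m + dot m m + dot m m by ring.
  rewrite lerDr.
  have -> : e - 2 * dot m m + dot m m =
      \sum_i lambda i * dot (P i - m) (P i - m).
    under [RHS]eq_bigr do rewrite si_expandB// mulrDr mulrBr mulrCA.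
    rewrite big_split sumrB /= -mulr_sumr -mulr_suml l1 mul1r.
    by rewrite -si_dot_suml.
  apply: sumr_ge0 => i _; apply: mulr_ge0; first exact: ltW.
  by apply: (si_ge0 H); exact: si_B.
rewrite -/m si_expandB// vm mulrBl mul1r.
have : E^-1 * dot v v <= e by rewrite mulrC ler_pdivrMr// mulrC.
lra.
Qed.

End SemiInner.

Lemma geometric_cvg0 (R : realType) (a : nat -> R) (rho : R) :
  0 <= rho < 1 -> (forall k, 0 <= a k) -> (forall k, a k.+1 <= rho * a k) ->
  a k @[k --> \oo] --> 0.
Proof.
move=> /andP[r0 r1] a0 aS.
have ak k : a k <= geometric (a 0%N) rho k.
  elim: k => [|k ih]; first by rewrite /geometric/= expr0 mulr1.
  apply: le_trans (aS k) _; rewrite /geometric/= exprS mulrCA.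
  exact: ler_wpM2l.
apply: (@squeeze_cvgr _ _ _ _ (fun=> 0) (geometric (a 0%N) rho)).
- by near=> k; rewrite a0 ak.
- exact: cvg_cst.
- by apply: cvg_geometric; rewrite ger0_norm.
Unshelve. all: by end_near. Qed.

(** * Square-integrable functions and adjoints *)

Lemma ae_imply (R : realType) (P Q : R -> Prop) : (forall t, P t -> Q t) ->
  (\forall t \ae (@lebesgue_measure R), P t) ->
  \forall t \ae (@lebesgue_measure R), Q t.
Proof. exact: (@filterS _ _ (ae_filter_ringOfSetsType lebesgue_measure)). Qed.

Lemma ae_and (R : realType) (P Q : R -> Prop) :
  (\forall t \ae (@lebesgue_measure R), P t) ->
  (\forall t \ae (@lebesgue_measure R), Q t) ->
  \forall t \ae (@lebesgue_measure R), P t /\ Q t.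
Proof. exact: (@filterI _ _ (ae_filter_ringOfSetsType lebesgue_measure)). Qed.

Section SquareIntegrable.
Context {R : realType} (T : R).
Notation mu := (@lebesgue_measure R).
Notation D := (`[0, T]%classic : set R).

Lemma Lfun2_le (f g : R -> R) : measurable_fun setT f ->
  (forall t, `|f t| <= `|g t|) -> g \in Lfun mu 2%:E -> f \in Lfun mu 2%:E.
Proof.
move=> mf fg g2; have /integrableP[_ ig] := Lfun_integrable (ler1n R 2) g2.
rewrite inE; apply/andP; split; rewrite inE//= /finite_norm unlock /Lnorm.
rewrite poweR_lty//=; apply: le_lt_trans ig.
have mg : measurable_fun setT g by move: g2; rewrite inE => /andP[]; rewrite inE.
have mp (h : R -> R) : measurable_fun setT h ->
    measurable_fun setT (EFin \o (fun x => `|h x| `^ 2)).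
  move=> mh; apply/measurable_EFinP.
  apply: (measurableT_comp (measurable_powR _)) => //.
  exact: measurableT_comp.
apply: ge0_le_integral => //=.
- exact: mp.
- under eq_fun do rewrite ger0_norm ?powR_ge0//; exact: mp.
- move=> t _; rewrite lee_fin [leRHS]ger0_norm ?powR_ge0//.
  by rewrite ge0_ler_powR// ?nnegrE.
Qed.

Lemma restrict_mul (f g : R -> R) :
  (fun t => f t * g t) \_ D = (f \_ D) \* (g \_ D).
Proof.
by apply/funext => t /=; rewrite !patchE; case: ifP => //; rewrite mulr0.
Qed.

Lemma Lfun2_integrable_mul (f g : R -> R) :
  f \_ D \in Lfun mu 2%:E -> g \_ D \in Lfun mu 2%:E ->
  mu.-integrable D (fun t => (f t * g t)%:E).
Proof.
move=> f2 g2; apply/integrable_mkcond => //.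
have := Lfun2_mul_Lfun1 f2 g2; rewrite -restrict_mul => /Lfun1_integrable.
by rewrite restrict_EFin.
Qed.

(** This is what makes the entries of [Phi(T, .) B] square integrable. *)
Lemma Lfun2_bounded_mul (phi f : R -> R) (c : R) : measurable_fun setT phi ->
  (forall t, `|phi t| <= c) -> f \_ D \in Lfun mu 2%:E ->
  (fun t => phi t * f t) \_ D \in Lfun mu 2%:E.
Proof.
move=> mphi phic f2.
have -> : (fun t => phi t * f t) \_ D = phi \* (f \_ D).
  by apply/funext => t /=; rewrite !patchE; case: ifP => //; rewrite mulr0.
apply: (@Lfun2_le _ (c \o* (f \_ D))) => [|t|].
- apply: measurable_funM => //.
  by move: f2; rewrite inE => /andP[]; rewrite inE.
- rewrite /= !normrM mulrC ler_wpM2l//.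
  by rewrite (le_trans (phic t))// ler_norm.
- by apply: Lfun_scale => //; rewrite ler1n.
Qed.

Lemma dotvE n (x y : 'cV[R]_n) : dotv x y = \sum_i x i 0 * y i 0.
Proof. by rewrite /dotv mxE; apply: eq_bigr => i _; rewrite mxE. Qed.

Section Vectors.
Variable m : nat.
Implicit Types u v w : R -> 'cV[R]_m.

Lemma integrable_dotv u v : Lp 2%:E T u -> Lp 2%:E T v ->
  mu.-integrable D (EFin \o (fun t => dotv (u t) (v t))).
Proof.
move=> u2 v2.
have -> : EFin \o (fun t => dotv (u t) (v t)) =
    (fun t => \sum_i (u t i 0 * v t i 0)%:E)%E.
  by apply/funext => t /=; rewrite dotvE sumEFin.
apply: integrable_sum => // i _.
by apply: (@Lfun2_integrable_mul (fun t => u t i 0) (fun t => v t i 0)).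
Qed.

Lemma fun_addE u v t i j : (u + v) t i j = u t i j + v t i j.
Proof. by rewrite -[LHS]/((u t + v t) i j) mxE. Qed.

Lemma fun_scaleE c u t i j : (c *: u) t i j = c * u t i j.
Proof. by rewrite -[LHS]/((c *: u t) i j) mxE. Qed.

Lemma Lp2_add u v : Lp 2%:E T u -> Lp 2%:E T v -> Lp 2%:E T (u + v).
Proof.
move=> u2 v2 i j.
have -> : (fun t => (u + v) t i j) \_ D =
    ((fun t => u t i j) \_ D) + ((fun t => v t i j) \_ D).
  apply/funext => t.
  rewrite -[RHS]/(((fun t => u t i j) \_ D) t + ((fun t => v t i j) \_ D) t).
  by rewrite !patchE; case: ifP => _; rewrite ?fun_addE//; exact/esym/addr0.
by apply: (Lfun_addr_closed mu (lee1n 2)).2; [exact: u2|exact: v2].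
Qed.

Lemma Lp2_scale (c : R) u : Lp 2%:E T u -> Lp 2%:E T (c *: u).
Proof.
move=> u2 i j.
have -> : (fun t => (c *: u) t i j) \_ D = c \o* ((fun t => u t i j) \_ D).
  apply/funext => t; rewrite /= !patchE.
  by case: ifP => _; rewrite ?fun_scaleE 1?mulrC//; exact/esym/mulr0.
by apply: Lfun_scale; [rewrite ler1n|exact: u2].
Qed.

Lemma Lp2_0 : Lp 2%:E T (0 : R -> 'cV[R]_m).
Proof.
move=> i j; have -> : (fun t => (0 : R -> 'cV[R]_m) t i j) \_ D = 0.
  apply/funext => t; rewrite patchE; case: ifP => _ //.
  by rewrite -[LHS]/((0 : 'cV[R]_m) i j) mxE.
exact: (Lfun_addr_closed mu (lee1n 2)).1.
Qed.

Lemma L2_semi_inner : semi_inner [set u | Lp 2%:E T u] (@L2dot R T m).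
Proof.
split=> /=.
- exact: Lp2_0.
- exact: Lp2_add.
- exact: Lp2_scale.
- move=> u v _ _; apply: eq_Rintegral => t _.
  by rewrite !dotvE; apply: eq_bigr => i _; rewrite mulrC.
- move=> u v w u2 v2 w2; rewrite /L2dot -RintegralD//; try exact: integrable_dotv.
  apply: eq_Rintegral => t _; rewrite !dotvE -big_split /=.
  by apply: eq_bigr => i _; rewrite fun_addE mulrDl.
- move=> c u w u2 w2; rewrite /L2dot -RintegralZl//; last exact: integrable_dotv.
  apply: eq_Rintegral => t _; rewrite !dotvE big_distrr /=.
  by apply: eq_bigr => i _; rewrite fun_scaleE mulrA.
- move=> u u2; apply: Rintegral_ge0 => t _; rewrite dotvE.
  by apply: sumr_ge0 => i _; rewrite -expr2 sqr_ge0.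
Qed.

Lemma L2dot_eq0 u : Lp 2%:E T u ->
  L2dot T u u = 0 <-> u = 0 %[ae mu in D].
Proof.
move=> u2; have iu := integrable_dotv u2 u2.
have mdot : measurable_fun D (EFin \o (fun t => dotv (u t) (u t))).
  by case/integrableP: iu.
have d0 t : 0 <= dotv (u t) (u t).
  by rewrite dotvE; apply: sumr_ge0 => i _; rewrite -expr2 sqr_ge0.
have absE : (\int[mu]_(t in D) `|(EFin \o (fun t => dotv (u t) (u t))) t| =
    (L2dot T u u)%:E)%E.
  rewrite /L2dot /Rintegral fineK; last exact: integrable_fin_num.
  by apply: eq_integral => t _ /=; rewrite ger0_norm.
have ae := ae_eq_integral_abs mu (measurable_itv `[0, T]) mdot.
split=> [u0|u0].
  have /ae : (\int[mu]_(t in D) `|(EFin \o (fun t => dotv (u t) (u t))) t| = 0)%E.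
    by rewrite absE u0.
  apply: ae_imply => t /= ut Dt; have [] := ut Dt.
  rewrite dotvE => /eqP; rewrite psumr_eq0; last first.
    by move=> i _; rewrite -expr2 sqr_ge0.
  move=> /allP us; apply/matrixP => i j; rewrite !ord1 mxE.
  have /= := us i (mem_index_enum i).
  by rewrite mulf_eq0 orbb => /eqP.
have u0' : \forall t \ae mu, D t -> (dotv (u t) (u t))%:E = 0%E.
  apply: ae_imply u0 => t /= ut Dt; rewrite ut// dotvE big1// => i _.
  by rewrite mxE mul0r.
have : (\int[mu]_(t in D) `|(EFin \o (fun t => dotv (u t) (u t))) t| = 0)%E.
  exact/ae.
by rewrite absE => -[].
Qed.

Lemma L2norm_sqr u : L2norm T u ^+ 2 = L2dot T u u.
Proof.
rewrite sqr_sqrtr// /L2dot; apply: Rintegral_ge0 => t _; rewrite dotvE.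
by apply: sumr_ge0 => i _; rewrite -expr2 sqr_ge0.
Qed.

Lemma L2_ae_eq_dot u v w : Lp 2%:E T u -> Lp 2%:E T v -> Lp 2%:E T w ->
  u = v %[ae mu in D] -> L2dot T w u = L2dot T w v.
Proof.
move=> u2 v2 w2 uv; have uv2 := si_B L2_semi_inner u2 v2.
apply/eqP; rewrite -subr_eq0 -(si_dotBr L2_semi_inner)//; apply/eqP.
apply: (si_null L2_semi_inner) => //; apply/L2dot_eq0 => //.
by apply: ae_imply uv => t uvt Dt; rewrite -[LHS]/(u t - v t) uvt// subrr.
Qed.

Section Operator.
Variables (n : nat) (L : (R -> 'cV[R]_m) -> 'cV[R]_n) (g : 'I_n -> R -> 'cV[R]_m).
Hypothesis g2 : forall k, Lp 2%:E T (g k).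
Hypothesis LE : forall u k, Lp 2%:E T u -> L u k 0 = L2dot T u (g k).

(** The adjoint is a chosen element of a set of candidates; the combination of
    the [g k] with coefficients [x] shows that the set is not empty. *)
Lemma adjoint_spec x : Lp 2%:E T (adjoint T L x) /\
  forall u, Lp 2%:E T u -> L2dot T u (adjoint T L x) = dotv (L u) x.
Proof.
apply: (@xgetPex _ 0 [set v | Lp 2%:E T v /\
  forall u, Lp 2%:E T u -> L2dot T u v = dotv (L u) x]).
exists (\sum_k x k 0 *: g k); split.
  exact: (si_sum L2_semi_inner (fun k => x k 0) g2).
move=> u u2; rewrite (si_dot_sumr L2_semi_inner (fun k => x k 0))// dotvE.
by apply: eq_bigr => k _; rewrite mulrC LE.
Qed.

(** Surjectivity of [L L^*] from that of [L]: if [b = L w], the projection of [w]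
    on the span of the [g k] has the form [L^* x] up to a null function, and its
    image under [L] is still [b]. *)
Lemma gramian_inverse : controllable T L -> forall b,
  L (adjoint T L (inv_map (fun x => L (adjoint T L x)) b)) = b.
Proof.
move=> ctrl b; rewrite /inv_map.
apply: (@pinvK _ _ _ _ (fun x => L (adjoint T L x))).
have [w w2 <-] := ctrl b.
have [x xE] := normal_equations L2_semi_inner g2 w2.
rewrite inE /=; exists (\col_k x k) => //.
have [a2 aE] := adjoint_spec (\col_k x k).
apply/matrixP => k j; rewrite !ord1 !LE//.
have H := L2_semi_inner.
rewrite (si_C H a2 (g2 k)) aE// (si_C H w2 (g2 k)) -xE dotvE.
rewrite (si_dot_sumr H _ g2 (g2 k)); apply: eq_bigr => p _.
by rewrite mxE LE// mulrC.
Qed.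

End Operator.
End Vectors.
End SquareIntegrable.

(** * The iteration for operators given by finitely many functions *)

(** The [g i k] span the range of the adjoint of [L i], and [lift i b] is the
    element of that range which [L i] maps to [b]. *)
Lemma steering_iteration_converges (R : realType) (T : R) (n m N : nat)
    (L : 'I_N -> (R -> 'cV[R]_m) -> 'cV[R]_n)
    (g : 'I_N -> 'I_n -> R -> 'cV[R]_m)
    (xi : 'I_N -> 'cV[R]_n) (lambda : 'I_N -> R) (u : nat -> R -> 'cV[R]_m) :
  (forall i k, Lp 2%:E T (g i k)) ->
  (forall i v k, Lp 2%:E T v -> L i v k 0 = L2dot T v (g i k)) ->
  (forall i, controllable T (L i)) ->
  (forall i, 0 < lambda i) -> \sum_i lambda i = 1 ->
  let C := \bigcap_i steering_set T (L i) (xi i) in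
  let lift i b :=
    adjoint T (L i) (inv_map (fun x => L i (adjoint T (L i) x)) b) in
  C !=set0 ->
  (forall k, Lp 2%:E T (u k)) ->
  u 0%N = 0 %[ae lebesgue_measure in `[0, T]%classic] ->
  (forall k, u k.+1 = (u k - \sum_i lambda i *: lift i (L i (u k)))
                      + \sum_i lambda i *: lift i (xi i)
     %[ae lebesgue_measure in `[0, T]%classic]) ->
  exists us : R -> 'cV[R]_m,
    [/\ is_min_energy T C us,
        forall v, is_min_energy T C v ->
          v = us %[ae lebesgue_measure in `[0, T]%classic]
      & L2norm T (u k - us) @[k --> \oo] --> 0].
Proof.
move=> g2 LE ctrl l0 l1 C lift [w Cw] u2 u0 uS.
have H := @L2_semi_inner R T m.
have [i0 _] : exists i : 'I_N, true.
  case: (pickP 'I_N) => [i _|N0]; first by exists i.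
  by move: l1 => /eqP; rewrite big1 ?(eq_sym 0) ?oner_eq0// => i; have := N0 i.
have w2 : Lp 2%:E T w by have [] := Cw i0 I.
have adj i := adjoint_spec (g2 i) (LE i).
pose inv i b := inv_map (fun x => L i (adjoint T (L i) x)) b.
have lift2 i b : Lp 2%:E T (lift i b) by have [] := adj i (inv i b).
have lift_dot i b v : Lp 2%:E T v ->
    L2dot T v (lift i b) = \sum_p inv i b p 0 * L2dot T v (g i p).
  move=> v2; have [_ ->//] := adj i (inv i b).
  by rewrite dotvE; apply: eq_bigr => p _; rewrite LE// mulrC.
have lift_section i b : L i (lift i b) = b.
  exact: (gramian_inverse (g2 i) (LE i) (ctrl i)).
(* the minimizer: projection of a feasible control on the span of the g i k *)
pose gg (p : 'I_N * 'I_n) := g p.1 p.2.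
have gg2 p : [set u | Lp 2%:E T u] (gg p) by exact: g2.
have [x xE] := normal_equations H gg2 w2.
pose us := \sum_p x p *: gg p.
have us2 : Lp 2%:E T us by exact: (si_sum H x gg2).
have Cus : C us.
  move=> i _; split=> //; have [_ <-] := Cw i I.
  apply/matrixP => k j; rewrite !ord1 !LE// (si_C H us2 (g2 i k)).
  by rewrite (si_C H w2 (g2 i k)) -(xE (i, k)).
have us_dot v : Lp 2%:E T v ->
    L2dot T v us = \sum_i \sum_p x (i, p) * L2dot T v (g i p).
  move=> v2; rewrite (si_dot_sumr H x gg2 v2).
  by rewrite (pair_big xpredT xpredT (fun i p => x (i, p) * L2dot T v (g i p)));
    apply: eq_bigr => -[].
have C2 v : C v -> Lp 2%:E T v by move=> /(_ i0 I)[].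
have pythagoras v : C v ->
    L2dot T v v = L2dot T us us + L2dot T (v - us) (v - us).
  move=> Cv; have v2 := C2 _ Cv; have d2 := si_B H v2 us2.
  have : L2dot T (v - us) us = 0.
    rewrite us_dot// big1// => i _; rewrite big1// => p _.
    rewrite (si_dotBl H v2 us2 (g2 i p)) -!LE//.
    have [_ ->] := Cv i I; have [_ ->] := Cus i I.
    by rewrite subrr mulr0.
  rewrite (si_dotBl H v2 us2 us2) (si_expandB H v2 us2) => /eqP.
  by rewrite subr_eq0 => /eqP ->; ring.
exists us; split.
- split=> // v Cv; rewrite !L2norm_sqr (pythagoras v Cv) lerDl.
  exact: (si_ge0 H (si_B H (C2 _ Cv) us2)).
- move=> v [Cv /(_ us Cus)]; rewrite !L2norm_sqr (pythagoras v Cv) gerDl => d0.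
  have d2 := si_B H (C2 _ Cv) us2.
  have /(L2dot_eq0 d2) : L2dot T (v - us) (v - us) = 0.
    by apply/eqP; rewrite eq_le d0 (si_ge0 H d2).
  apply: ae_imply => t vt Dt; apply/eqP; rewrite -subr_eq0.
  by rewrite -[_ - _]/((v - us) t) vt.
have [rho rho01 contract] := averaged_projections_contract H g2 l0 l1.
pose e k := u k - us.
have e2 k : Lp 2%:E T (e k) := si_B H (u2 k) us2.
pose P k i := lift i (L i (u k)) - lift i (xi i).
have P2 k i : Lp 2%:E T (P k i) := si_B H (lift2 _ _) (lift2 _ _).
pose e' k := e k - \sum_i lambda i *: P k i.
have s2 k : Lp 2%:E T (\sum_i lambda i *: P k i) := si_sum H lambda (P2 k).
have e'2 k : Lp 2%:E T (e' k) := si_B H (e2 k) (s2 k).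
(* the recursion holds almost everywhere, which inner products do not see *)
have eS k v : Lp 2%:E T v -> L2dot T v (e k.+1) = L2dot T v (e' k).
  move=> v2; apply: L2_ae_eq_dot => //; apply: ae_imply (uS k) => t ut Dt.
  rewrite -[LHS]/(u k.+1 t - us t) ut//.
  have -> : e' k = (u k - \sum_i lambda i *: lift i (L i (u k)) +
      \sum_i lambda i *: lift i (xi i)) - us.
    rewrite /e' /e /P; under eq_bigr do rewrite scalerBr.
    rewrite sumrB opprB addrA -!addrA; congr (_ + _).
    by rewrite [RHS]addrC -!addrA [RHS]addrC -!addrA; congr (_ + _); rewrite addrC.
  by [].
(* the error stays in the span of all the g i k *)
have e_span k : exists y : 'I_N -> 'I_n -> R, forall v, Lp 2%:E T v ->
    L2dot T v (e k) = \sum_i \sum_p y i p * L2dot T v (g i p).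
  elim: k => [|k [y yE]].
    exists (fun i p => - x (i, p)) => v v2.
    rewrite (si_dotBr H (u2 0%N) us2 v2) us_dot//.
    rewrite (L2_ae_eq_dot (u2 0%N) (si_0 H) v2 u0).
    have -> : L2dot T v 0 = 0.
      by rewrite -(scale0r 0) (si_dotZr H _ (si_0 H) v2) mul0r.
    rewrite sub0r -sumrN; apply: eq_bigr => i _; rewrite -sumrN.
    by apply: eq_bigr => p _; rewrite mulNr.
  exists (fun i p => y i p -
    lambda i * (inv i (L i (u k)) p 0 - inv i (xi i) p 0)) => v v2.
  rewrite eS// (si_dotBr H (e2 k) (s2 k) v2) yE//.
  rewrite (si_dot_sumr H lambda (P2 k) v2) -sumrB; apply: eq_bigr => i _.
  rewrite (si_dotBr H (lift2 _ _) (lift2 _ _) v2) !lift_dot//.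
  rewrite -sumrB mulr_sumr -sumrB; apply: eq_bigr => p _; ring.
have Pg k i p : L2dot T (P k i) (g i p) = L2dot T (e k) (g i p).
  rewrite (si_dotBl H (lift2 _ _) (lift2 _ _) (g2 i p)).
  rewrite (si_dotBl H (u2 k) us2 (g2 i p)) -!LE// !lift_section.
  by have [_ <-] := Cus i I.
have eP k i : L2dot T (e k) (P k i) = L2dot T (P k i) (P k i).
  rewrite !(si_dotBr H (lift2 _ _) (lift2 _ _)) ?lift_dot//; [|exact: P2|exact: e2].
  by congr (_ - _); apply: eq_bigr => p _; rewrite Pg.
have eS_le k : L2dot T (e k.+1) (e k.+1) <= rho * L2dot T (e k) (e k).
  have [y yE] := e_span k.
  rewrite eS// (si_C H (e2 k.+1) (e'2 k)) eS//.
  exact: (contract (e k) y (P k) (e2 k) yE (P2 k) (Pg k) (eP k)).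
have := geometric_cvg0 rho01 (fun k => si_ge0 H (e2 k)) eS_le.
move=> /(continuous_cvg _ (@sqrt_continuous R 0)); rewrite sqrtr0.
exact.
Qed.

(** * Absolutely continuous functions *)

Section Lipschitz.
Context {R : realType}.
Notation mu := (@lebesgue_measure R).

(** Cousin's covering argument in the form of an induction principle: the
    supremum of the points reached from [a] cannot lie below [b]. *)
Lemma interval_induction (a b : R) (P : R -> Prop) : a <= b -> P a ->
  (forall t, a <= t <= b -> exists2 r, 0 < r & forall x y,
     a <= x -> t - r < x -> x <= t -> t <= y -> y < t + r -> y <= b ->
     P x -> P y) ->
  P b.
Proof.
move=> ab Pa step.
pose S := [set c | a <= c <= b /\ P c].
have Sa : S a by split=> //; rewrite lexx ab.
have hS : has_sup S by split; [exists a|exists b => c []/andP[]].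
have le_sup c : S c -> c <= sup S by move=> Sc; exact: sup_upper_bound.
have supb : sup S <= b by apply: ge_sup; [exists a|move=> c []/andP[]].
have [r r0 stepr] : exists2 r, 0 < r & forall x y,
     a <= x -> sup S - r < x -> x <= sup S -> sup S <= y ->
     y < sup S + r -> y <= b -> P x -> P y.
  by apply: step; rewrite supb le_sup.
have [x Sx rx] := sup_adherent r0 hS.
have [[/andP[ax xb] Px] xs] := (Sx, le_sup _ Sx).
have Py y : sup S <= y -> y < sup S + r -> y <= b -> P y.
  by move=> sy yr yb; exact: (stepr x y).
have [bs|sb] := leP b (sup S + r / 2).
  by apply: Py => //; lra.
have Sy : S (sup S + r / 2).
  split; last by apply: Py; lra.
  by apply/andP; split; have := le_sup _ Sa; lra.
by have := le_sup _ Sy; lra.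
Qed.

Lemma abs_continuous_sub (a b a' b' : R) f : a <= a' -> b' <= b ->
  abs_continuous a b f -> abs_continuous a' b' f.
Proof.
move=> aa bb acf e e0; have [d d0 fd] := acf e e0; exists d => // k x y xy.
by apply: fd => i; have [? [? ?]] := xy i; split; [|split] => //; lra.
Qed.

Lemma abs_continuous_uniform (a b : R) f : abs_continuous a b f ->
  forall e : R, 0 < e -> exists2 d : R, 0 < d & forall x y,
    a <= x <= b -> a <= y <= b -> `|y - x| < d -> `|f y - f x| < e.
Proof.
move=> acf e e0; have [d d0 fd] := acf e e0; exists d => // x y.
wlog xy : x y / x <= y => [hw xab yab|/andP[ax _] /andP[_ yb]].
  have [xy|/ltW yx] := leP x y; first exact: hw.
  by rewrite distrC (distrC (f y)); exact: hw.
rewrite ger0_norm ?subr_ge0// => yxd.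
have := fd 1%N (fun=> x) (fun=> y); rewrite !big_ord1; apply=> //.
by move=> i j; rewrite !ord1.
Qed.

Lemma abs_continuous_seq (a b : R) f : abs_continuous a b f ->
  forall e : R, 0 < e -> exists2 d : R, 0 < d & forall s : seq (R * R),
    all (fun p => a <= p.1 <= p.2) s -> all (fun p => p.2 <= b) s ->
    pairwise (fun p q => p.2 <= q.1) s ->
    \sum_(p <- s) (p.2 - p.1) < d -> \sum_(p <- s) `|f p.2 - f p.1| < e.
Proof.
move=> acf e e0; have [d d0 fd] := acf e e0; exists d => // s sa sb sd.
rewrite !(big_nth (0, 0)) !big_mkord => sumd.
apply: (fd _ (fun i => (nth (0, 0) s i).1) (fun i => (nth (0, 0) s i).2)) => //.
  move=> i; have is_ : (nth (0, 0) s i) \in s by exact: mem_nth.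
  by have /allP/(_ _ is_)/andP[? ?] := sa; have /allP/(_ _ is_) := sb.
move=> i j; rewrite neq_lt => /orP[] ij; [left|right];
  by move/(pairwiseP (0, 0)): sd; apply=> //; rewrite inE.
Qed.

(** As the two points lie on opposite sides of [t], the increments from [t] to
    each of them add up to the increment between them. *)
Lemma is_derive_increment (f : R -> R) (t d M : R) : is_derive t (1 : R) f d ->
  `|d| < M -> exists2 r, 0 < r & forall x y,
    t - r < x -> x <= t -> t <= y -> y < t + r -> `|f y - f x| <= M * (y - x).
Proof.
move=> fd dM.
have [r r0 near_t] : exists2 r, 0 < r &
    forall h, `|h| < r -> `|f (t + h) - f t| <= M * `|h|.
  have : h^-1 *: ((f \o shift t) (h *: (1 : R)) - f t) @[h --> 0^'] --> d.
    rewrite -(@derive_val _ _ _ _ _ _ _ fd).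
    exact: (@ex_derive _ _ _ _ _ _ _ fd).
  move=> /cvgrPdist_lt/(_ (M - `|d|)); rewrite subr_gt0 => /(_ dM).
  move=> [r /= r0 fr]; exists r => // h hr.
  have [->|h0] := eqVneq h 0; first by rewrite addr0 subrr normr0 mulr0.
  have := fr h; rewrite /ball_/= sub0r normrN => /(_ hr h0).
  rewrite scaler1 => lt_d.
  have : `|h^-1 * (f (h + t) - f t)| < M.
    rewrite -[X in `|X|](subKr d); apply: le_lt_trans (ler_normB _ _) _.
    by rewrite -ltrBrDl.
  rewrite normrM normfV (addrC h) => /ltW.
  have hgt0 : 0 < `|h| by rewrite normr_gt0.
  by rewrite ler_pdivrMl// [`|h| * M]mulrC.
exists r => // x y xr xt ty yr.
have := near_t (y - t); have := near_t (x - t).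
rewrite !subrKC (ler0_norm (x := x - t)) ?subr_le0//.
rewrite (ger0_norm (x := y - t)) ?subr_ge0//.
move=> fx fy; have {}fx := fx ltac:(lra); have {}fy := fy ltac:(lra).
have := ler_distD (f t) (f y) (f x).
by rewrite (distrC (f t)); lra.
Qed.

(** Points where the bound on the derivative fails, together with the end
    points, form a null set, covered by an open [U] of measure less than the [d]
    that absolute continuity provides for [e]. Going from [a] to [b] by small
    steps, a step around a point outside [U] changes [f] by at most [M + e]
    times its length, and the other steps stay in [U]. The latter are collected
    in a list whose total length is at most the measure of [U], so that they
    contribute at most [e] altogether. *)
Lemma abs_continuous_lipschitz (a b M : R) (f : R -> R) : a <= b -> 0 <= M ->
  abs_continuous a b f ->
  {ae mu, forall t, t \in `]a, b[ ->
    exists2 d, is_derive t (1 : R) f d & `|d| <= M} ->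
  `|f b - f a| <= M * (b - a).
Proof.
move=> ab M0 acf fae.
suff slack e : 0 < e -> `|f b - f a| <= (M + e) * (b - a) + e.
  apply/ler_addgt0Pr => e e0; have ba0 : 0 < b - a + 1 by lra.
  have := slack (e / (b - a + 1)) (divr_gt0 e0 ba0).
  suff -> : (M + e / (b - a + 1)) * (b - a) + e / (b - a + 1) =
    M * (b - a) + e by [].
  by field; rewrite gt_eqF.
move=> e0; have [d d0 fd] := abs_continuous_seq acf e0.
have [A [mA A0 Abad]] := fae.
pose Z := A `|` [set a] `|` [set b].
have mZ : measurable Z by do 2 apply: measurableU => //.
have Z0 : mu Z = 0%E.
  have mAa : measurable (A `|` [set a]) by exact: measurableU.
  rewrite !measureU0 //; try exact: lebesgue_measure_set1; exact: A0.
have muZ : (mu Z < +oo)%E by rewrite Z0.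
have [U [oU ZU muUZ]] := lebesgue_regularity_outer mZ muZ d0.
have mU : measurable U by exact: open_measurable.
have muU : (mu U < d%:E)%E.
  rewrite -(setDUK ZU) setUC measureU0//; exact: measurableD.
have le_mu (X Y : set R) : measurable X -> measurable Y -> X `<=` Y ->
    (mu X <= mu Y)%E.
  by move=> mX mY XY; apply: le_measure => //; rewrite inE; [exact: mX|exact: mY].
(* the length of the part of U between a and c *)
pose m c := fine (mu (U `&` `[a, c[)).
have m_meas c : measurable (U `&` `[a, c[) by exact: measurableI.
have m_lt c : (mu (U `&` `[a, c[) < d%:E)%E.
  by apply: le_lt_trans muU; apply: (le_mu _ _ (m_meas c) mU).
have m_fin c : mu (U `&` `[a, c[) \is a fin_num.
  by rewrite ge0_fin_numE//; apply: lt_trans (m_lt c) (ltry d).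
have m_le x y : x <= y -> m x <= m y.
  move=> xy; apply: fine_le => //; apply: (le_mu _ _ (m_meas x) (m_meas y)).
  by apply: setIS; apply: subset_itvl; rewrite bnd_simp.
have m_add x y : a <= x -> x <= y -> (`[x, y[ `<=` U) -> m x + (y - x) <= m y.
  move=> ax xy xyU.
  have xyE : mu `[x, y[ = (y - x)%:E.
    rewrite lebesgue_measure_itv/= lte_fin.
    by case: ltgtP xy => // -> _; rewrite subrr.
  rewrite -lee_fin EFinD /m !fineK// -xyE.
  have disj : (U `&` `[a, x[) `&` `[x, y[ = set0.
    apply/seteqP; split=> // z /= [[_]]; rewrite !in_itv/= => /andP[_ zx] /andP[].
    by rewrite leNgt zx.
  rewrite -measureU; [|exact: m_meas|exact: measurable_itv|exact: disj].
  apply: (le_mu _ _ _ (m_meas y)).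
    by apply: measurableU; [exact: m_meas|exact: measurable_itv].
  move=> z /= [[Uz]|xyz]; rewrite !in_itv/=.
    by move=> /andP[-> zx]; split=> //; exact: lt_le_trans xy.
  split; first exact: xyU; move: xyz; rewrite in_itv/= => /andP[xz ->].
  by rewrite (le_trans ax xz).
(* the list s holds the steps made inside U *)
pose good c := exists s : seq (R * R),
  [/\ all (fun p => a <= p.1 <= p.2) s, all (fun p => p.2 <= c) s,
      pairwise (fun p q => p.2 <= q.1) s,
      \sum_(p <- s) (p.2 - p.1) <= m c &
      `|f c - f a| <= (M + e) * (c - a) + \sum_(p <- s) `|f p.2 - f p.1|].
suff [s [sa sb sd sm fs]] : good b.
  apply: le_trans fs _; rewrite lerD2l; apply/ltW/fd => //.
  by apply: le_lt_trans sm _; rewrite -lte_fin fineK.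
apply: (interval_induction ab).
  exists [::]; split=> //; rewrite ?big_nil; first by rewrite fine_ge0.
  by rewrite !subrr normr0 mulr0 addr0.
move=> t /andP[at_ tb].
have [Ut|nUt] := pselect (U t).
  have /nbhs_ballP[r /= r0 rU] : nbhs t U by exact: open_nbhs_nbhs.
  exists r => // x y ax xr xt ty yr yb [s [sa sc sd sm fs]].
  have xy := le_trans xt ty.
  exists (rcons s (x, y)); split.
  - by rewrite all_rcons sa /= ax xy.
  - rewrite all_rcons /= lexx /=; apply: sub_all sc => p /le_trans; exact.
  - rewrite pairwise_rcons sd andbT; apply: sub_all sc => p px; exact: px.
  - rewrite -cats1 big_cat big_seq1 /=; apply: le_trans (m_add x y ax xy _).
      by rewrite lerD2r.
    move=> z /=; rewrite in_itv/= => /andP[xz zy]; apply: rU.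
    by rewrite /ball/= ltr_norml; lra.
  - rewrite -cats1 big_cat big_seq1 /=; have := ler_distD (f x) (f y) (f a).
    have : (M + e) * (x - a) <= (M + e) * (y - a).
      by apply: ler_wpM2l; [lra|rewrite lerD2r].
    by move: fs; lra.
have tA : ~ A t by move=> At; apply: nUt; apply: ZU; left; left.
have ta : t != a by apply/eqP => ta; apply: nUt; apply: ZU; left; right.
have tb' : t != b by apply/eqP => tb'; apply: nUt; apply: ZU; right.
have [D fD DM] : exists2 d, is_derive t (1 : R) f d & `|d| <= M.
  apply: contrapT => nd; apply: tA; apply: Abad => /= /(_ _)h; apply: nd.
  by apply: h; rewrite in_itv/= !lt_neqAle at_ tb eq_sym ta tb'.
have [|r r0 fr] := is_derive_increment (M := M + e) fD; first lra.
exists r => // x y ax xr xt ty yr yb [s [sa sc sd sm fs]].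
exists s; split=> //.
- by apply: sub_all sc => p /le_trans; apply; exact: le_trans ty.
- by apply: le_trans sm (m_le _ _ _); exact: le_trans ty.
- have := fr x y xr xt ty yr; have := ler_distD (f x) (f y) (f a).
  by move: fs; lra.
Qed.

End Lipschitz.

Lemma abs_continuousD (R : realType) (a b : R) f g :
  abs_continuous a b f -> abs_continuous a b g ->
  abs_continuous a b (fun t => f t + g t).
Proof.
move=> acf acg e e0; have e20 : 0 < e / 2 by rewrite divr_gt0.
have [d d0 fd] := acf _ e20; have [d' d'0 gd] := acg _ e20.
exists (Num.min d d') => [|k x y xy dis].
  by rewrite lt_min d0.
rewrite lt_min => /andP[sd sd']; rewrite (splitr e).
apply: le_lt_trans (ltrD (fd _ _ _ xy dis sd) (gd _ _ _ xy dis sd')).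
rewrite -big_split; apply: ler_sum => i _ /=.
by rewrite opprD addrACA ler_normD.
Qed.

Lemma abs_continuousZ (R : realType) (a b c : R) f :
  abs_continuous a b f -> abs_continuous a b (fun t => c * f t).
Proof.
move=> acf e e0; have c0 : 0 < `|c| + 1 by rewrite ltr_wpDl.
have [d d0 fd] := acf _ (divr_gt0 e0 c0).
exists d => // k x y xy dis sd.
have := fd _ _ _ xy dis sd; rewrite ltr_pdivlMr// => /(le_lt_trans _); apply.
rewrite mulrC mulr_sumr; apply: ler_sum => i _.
by rewrite -mulrBr normrM ler_wpM2r// lerDl.
Qed.

Lemma abs_continuous_sum (R : realType) (a b : R) n (f : 'I_n -> R -> R) :
  (forall i, abs_continuous a b (f i)) ->
  abs_continuous a b (fun t => \sum_i f i t).
Proof.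
move=> acf; elim: n f acf => [|n ih] f acf.
  move=> e e0; exists 1 => // k x y _ _ _.
  by rewrite big1// => i _; rewrite !big_ord0 subrr normr0.
under eq_fun do rewrite big_ord_recl.
exact: (abs_continuousD (acf ord0) (ih _ (fun i => acf (lift ord0 i)))).
Qed.

(** * Linear differential equations and transition matrices *)

(** Uniqueness for [Y' = A Y]. If [Y r = 0] and [|Y| <= K] within distance [h] of
    [r], the Lipschitz estimate improves the bound to [n M h K <= K / 2]; hence [Y]
    vanishes within distance [h] of [r]. As [h] does not depend on [r], the zero
    propagates over the whole interval in both directions. *)
Lemma linear_ode_zero (R : realType) (n p : nat) (a b M : R)
    (A : R -> 'M[R]_n) (Y : R -> 'M[R]_(n, p)) :
  a <= b -> 0 <= M ->
  (forall i j, abs_continuous a b (fun t => Y t i j)) ->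
  {ae lebesgue_measure, forall t, t \in `]a, b[ ->
     forall i j, is_derive t (1 : R) (fun t => Y t i j) ((A t *m Y t) i j)} ->
  {ae lebesgue_measure, forall t, t \in `]a, b[ -> forall i j, `|A t i j| <= M} ->
  forall s t, s \in `[a, b] -> t \in `[a, b] -> Y s = 0 -> Y t = 0.
Proof.
move=> ab M0 acY dY bA.
have [d d0 Yd] : exists2 d : R, 0 < d & forall i j x y,
    a <= x <= b -> a <= y <= b -> `|y - x| < d -> `|Y y i j - Y x i j| < 1.
  have /choice[D DP] : forall ij : 'I_n * 'I_p, exists d : R, 0 < d /\
      forall x y, a <= x <= b -> a <= y <= b -> `|y - x| < d ->
      `|Y y ij.1 ij.2 - Y x ij.1 ij.2| < 1.
    move=> ij; have [d ? ?] := abs_continuous_uniform (acY ij.1 ij.2) ltr01.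
    by exists d.
  exists (\big[Num.min/1]_ij D ij).
    by apply: lt_bigmin => // ij _; have [] := DP ij.
  move=> i j x y xab yab xyd; have [_] := DP (i, j); apply=> //.
  by apply: lt_le_trans xyd _; exact: bigmin_le.
pose nM := n%:R * M.
have nM0 : 0 <= nM by rewrite mulr_ge0.
(* d gives the bound |Y| <= 1 near a zero; with the other term, each use of
   the Lipschitz estimate halves the bound *)
pose h := Num.min d (2 * (nM + 1))^-1.
have h0 : 0 < h by rewrite lt_min d0 invr_gt0; lra.
have hd : h <= d by rewrite ge_min lexx.
have hM : nM * h <= 2^-1.
  apply: (@le_trans _ _ (nM * (2 * (nM + 1))^-1)).
    by rewrite ler_wpM2l// ge_min lexx orbT.
  by rewrite ler_pdivrMr; lra.
have local r t : a <= r <= b -> a <= t <= b -> `|t - r| < h -> Y r = 0 -> Y t = 0.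
  move=> rab tab trh Yr.
  suff Yk k : forall t, a <= t <= b -> `|t - r| < h ->
      forall i j, `|Y t i j| <= 2^-1 ^+ k.
    apply/matrixP => i j; rewrite mxE; apply/eqP; rewrite -normr_le0.
    have c : (2^-1 : R) ^+ k @[k --> \oo] --> 0.
      by apply: cvg_expr; rewrite ger0_norm ?invf_lt1 ?ltr1n.
    rewrite -(cvg_lim _ c)//; apply: limr_ge; first by apply/cvg_ex; exists 0.
    by apply: nearW => k; exact: Yk.
  elim: k {t tab trh} => [|k ih] t tab trh i j.
    have := Yd i j r t rab tab (lt_le_trans trh hd).
    by rewrite Yr mxE subr0 expr0 => /ltW.
  have -> : `|Y t i j| = `|Y (Num.max r t) i j - Y (Num.min r t) i j|.
    by case: (leP r t) => _; rewrite Yr mxE ?subr0// sub0r normrN.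
  have rt : `|t - r| = Num.max r t - Num.min r t.
    case: (leP r t) => [rt|/ltW tr]; first by rewrite ger0_norm// subr_ge0.
    by rewrite ler0_norm ?subr_le0// opprB.
  have := @abs_continuous_lipschitz _ (Num.min r t) (Num.max r t)
    (nM * 2^-1 ^+ k) (fun t => Y t i j).
  rewrite -rt ge_min le_max lexx /= => /(_ isT)Lip.
  apply: le_trans (Lip _ _ _) _.
  - by rewrite mulr_ge0// exprn_ge0// invr_ge0.
  - apply: abs_continuous_sub (acY i j).
      by rewrite le_min; case/andP: rab => ->; case/andP: tab => ->.
    by rewrite ge_max; case/andP: rab => _ ->; case/andP: tab => _ ->.
  - apply: ae_imply (ae_and dY bA) => z [dYz bAz]; rewrite in_itv/= => /andP[rz zt].
    have zab : z \in `]a, b[.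
      rewrite in_itv/=; apply/andP; split.
        apply: le_lt_trans rz; rewrite le_min.
        by case/andP: rab => ->; case/andP: tab => ->.
      apply: lt_le_trans zt _; rewrite ge_max.
      by case/andP: rab => _ ->; case/andP: tab => _ ->.
    exists ((A z *m Y z) i j); first exact: dYz.
    rewrite mxE; apply: le_trans (ler_norm_sum _ _ _) _.
    rewrite -mulrA mulr_natl -[in leRHS](card_ord n) -sumr_const.
    apply: ler_sum => l _; rewrite normrM; apply: ler_pM => //; first exact: bAz.
    have zrh : `|z - r| < h.
      apply: le_lt_trans trh; rewrite rt; move: rz zt.
      by rewrite ler_norml; case: (leP r t) => _ rz zt; lra.
    by apply: ih => //; move: zab; rewrite in_itv/= => /andP[/ltW -> /ltW ->].
  rewrite mulrAC exprS ler_wpM2r ?exprn_ge0 ?invr_ge0//.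
  by apply: le_trans hM; rewrite ler_wpM2l// ltW.
have start c : a <= c <= b -> (Y a = 0 <-> Y c = 0).
  move=> /andP[ac cb].
  apply: (interval_induction (P := fun c => Y a = 0 <-> Y c = 0) ac) => //.
  move=> t /andP[at_ tc]; exists (h / 2); first by rewrite divr_gt0.
  move=> x y ax tx xt ty yt yc ->.
  have xab : a <= x <= b by lra.
  have yab : a <= y <= b by lra.
  have yx : `|y - x| < h by rewrite ger0_norm; lra.
  by split; apply: local => //; rewrite distrC.
move=> s t; rewrite !in_itv/= => sab tab Ys.
by apply/(start t tab)/(start s sab).
Qed.

Lemma Lp_oo_bound (R : realType) (T : R) (n m : nat) (A : R -> 'M[R]_(n, m)) :
  Lp +oo%E T A -> exists2 M, 0 <= M &
  {ae lebesgue_measure, forall t, t \in `]0, T[ -> forall i j, `|A t i j| <= M}.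
Proof.
move=> Aoo.
have entry i j : exists M, {ae (@lebesgue_measure R), forall t, t \in `]0, T[ ->
    `|A t i j| <= M}.
  have := Aoo i j; rewrite inE => /andP[_]; rewrite inE /= /finite_norm unlock /Lnorm.
  have muR : (0 < (@lebesgue_measure R) [set: R])%E.
    by rewrite -(@set_itvNyy _ R) lebesgue_measure_itv/= ltry.
  rewrite ifT; last exact: muR.
  move=> fin; have [M AM] := ess_supr_bounded (mu := @lebesgue_measure R)
    (f := fun t => `|((fun t => A t i j) \_ `[0, T]) t|) fin.
  exists M; apply: ae_imply AM => t /= + t0T; rewrite patchE ifT//.
  by rewrite inE/=; exact: subset_itv_oo_cc.
have /choice[M MP] : forall ij : 'I_n * 'I_m, exists M : R,
    {ae (@lebesgue_measure R), forall t, t \in `]0, T[ -> `|A t ij.1 ij.2| <= M}.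
  by move=> ij; exact: entry.
exists (\big[Num.max/0]_ij M ij); first exact: bigmax_ge_id.
pose good (ij : 'I_n * 'I_m) t := t \in `]0, T[ -> `|A t ij.1 ij.2| <= M ij.
suff : {ae (@lebesgue_measure R), forall t, forall ij, good ij t}.
  apply: ae_imply => t goodt t0T i j.
  apply: le_trans (goodt (i, j) t0T) _; exact: le_bigmax.
suff : {ae (@lebesgue_measure R), forall t, forall ij,
    ij \in enum {: 'I_n * 'I_m} -> good ij t}.
  by apply: ae_imply => t goodt ij; apply: goodt; rewrite mem_enum.
elim: (enum _) => [|ij s ih]; first exact: aeW.
apply: ae_imply (ae_and (MP ij) ih) => t [g1 g2] kl.
rewrite inE => /orP[/eqP->|] //.
exact: g2.
Qed.

Lemma continuous_det (R : realType) (n : nat) (M : R -> 'M[R]_n) :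
  (forall i j, continuous (fun t => M t i j)) -> continuous (fun t => \det (M t)).
Proof.
move=> cM; apply: continuous_big => [|s _ t]; first exact: add_continuous.
apply: cvgM; first exact: cvg_cst.
apply: continuous_big => [|i _]; [exact: mul_continuous|exact: cM].
Qed.

Lemma continuous_invmx (R : realType) (n : nat) (M : R -> 'M[R]_n) :
  (forall i j, continuous (fun t => M t i j)) -> (forall t, M t \in unitmx) ->
  forall i j, continuous (fun t => invmx (M t) i j).
Proof.
move=> cM uM i j.
have -> : (fun t => invmx (M t) i j) =
    (fun t => (\det (M t))^-1 * ((-1) ^+ (j + i) * \det (row' j (col' i (M t))))).
  by apply/funext => t; rewrite /invmx uM !mxE.
move=> t; apply: cvgM; first apply: cvgV.
- by have := uM t; rewrite unitmxE unitfE.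
- exact: continuous_det.
- apply: cvgM; first exact: cvg_cst.
  apply: (continuous_det (M := fun t => row' j (col' i (M t)))) => k l.
  by under eq_fun do rewrite !mxE; exact: cM.
Qed.

(** As functions of [t], both sides solve the same linear equation and they
    agree at [t = s]. *)
Lemma transition_matrix_cocycle (R : realType) (T : R) (n : nat)
    (A : R -> 'M[R]_n) (Phi : R -> R -> 'M[R]_n) :
  0 <= T -> Lp +oo%E T A -> transition_matrix T A Phi ->
  forall s t, s \in `[0, T] -> t \in `[0, T] ->
  Phi t s *m Phi s 0 = Phi t 0.
Proof.
move=> T0 Aoo tPhi s t sT tT.
have [M M0 AM] := Lp_oo_bound Aoo.
have z0 : 0 \in `[0, T] by rewrite in_itv/= lexx.
have [Phis acs dPhis] := tPhi s sT; have [_ ac0 dPhi0] := tPhi 0 z0.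
pose Y t := Phi t s *m Phi s 0 - Phi t 0.
have YE i j : (fun t => Y t i j) = (fun t =>
    \sum_l Phi s 0 l j * Phi t s i l + (-1) * Phi t 0 i j).
  apply/funext => z; rewrite !mxE mulN1r; congr (_ - _).
  by apply: eq_bigr => l _; rewrite mulrC.
apply/eqP; rewrite -subr_eq0; apply/eqP.
apply: (linear_ode_zero (Y := Y) T0 M0 _ _ AM sT tT).
- move=> i j; rewrite YE; apply: abs_continuousD; last exact: abs_continuousZ.
  by apply: abs_continuous_sum => l; exact: abs_continuousZ.
- apply: ae_imply (ae_and dPhis dPhi0) => z [dzs dz0] zT i j.
  have -> : (fun t => Y t i j) =
      \sum_l (Phi s 0 l j \*: (fun t => Phi t s i l)) - (fun t => Phi t 0 i j).
    rewrite YE; apply/funext => x.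
    by rewrite -[RHS]/(_ x - _ x) fct_sumE mulN1r.
  have -> : (A z *m Y z) i j =
      \sum_l Phi s 0 l j *: (A z *m Phi z s) i l - (A z *m Phi z 0) i j.
    rewrite /Y mulmxBr mulmxA mxE [X in _ + X]mxE; congr (_ - _).
    by rewrite mxE; apply: eq_bigr => l _; rewrite mulrC.
  apply: is_deriveB; last exact: dz0.
  by apply: is_derive_sum => l; apply: is_deriveZ; exact: dzs.
- by rewrite /Y Phis mul1mx subrr.
Qed.

(** [Phi(T, s) = Phi(T, 0) Phi(s, 0)^-1] is continuous in [s]. Nothing is known
    about [Phi] outside the interval, so [s] is first clamped to it; the result
    is a function on the whole line, as the cut-off description of L^2 requires. *)
Lemma transition_matrix_bounded_measurable (R : realType) (T : R) (n : nat)
    (A : R -> 'M[R]_n) (Phi : R -> R -> 'M[R]_n) :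
  0 <= T -> Lp +oo%E T A -> transition_matrix T A Phi ->
  exists psi : R -> 'M[R]_n,
    [/\ forall t, t \in `[0, T] -> Phi T t = psi t,
        forall i j, measurable_fun [set: R] (fun t => psi t i j) &
        exists c, forall i j t, `|psi t i j| <= c].
Proof.
move=> T0 Aoo tPhi.
have cocycle := transition_matrix_cocycle T0 Aoo tPhi.
have z0 : 0 \in `[0, T] by rewrite in_itv/= lexx.
have TT : T \in `[0, T] by rewrite in_itv/= lexx T0.
have [Phi00 ac0 _] := tPhi 0 z0.
pose clamp (t : R) := Num.max 0 (Num.min t T).
have clampT t : 0 <= clamp t <= T.
  by rewrite le_max lexx ge_max T0 ge_min lexx orbT.
have clamp_id t : t \in `[0, T] -> clamp t = t.
  by rewrite in_itv/= => /andP[t0 tT]; rewrite /clamp (min_idPl tT) (max_idPr t0).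
have clamp_lip x y : `|clamp y - clamp x| <= `|y - x|.
  have TE : Num.max 0 T = T by exact/max_idPr.
  have := ler_norm (y - x); have := ler_norm (- (y - x)); rewrite normrN ler_norml.
  rewrite /clamp; case: (leP x T) => xT; case: (leP y T) => yT;
    rewrite ?TE; case: (leP 0 x) => x0; case: (leP 0 y) => y0; lra.
pose M t := Phi (clamp t) 0.
have cM i j : continuous (fun t => M t i j).
  move=> t; apply/cvgrPdist_lt => e e0.
  have [d d0 uc] := abs_continuous_uniform (ac0 i j) e0.
  exists d => // x /= tx; apply: uc => //.
  exact: le_lt_trans tx.
have uM t : M t \in unitmx.
  have cT : clamp t \in `[0, T] by rewrite in_itv/=.
  have := cocycle _ _ cT z0; rewrite Phi00 => /mulmx1_unit[_].
  by [].
pose psi t := Phi T 0 *m invmx (M t).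
have cpsi i j : continuous (fun t => psi t i j).
  move=> t; under eq_fun do rewrite mxE.
  apply: continuous_big => [|l _ {}t]; first exact: add_continuous.
  by apply: cvgM; [exact: cvg_cst|exact: continuous_invmx].
exists psi; split.
- move=> t tT; rewrite /psi /M clamp_id// -(cocycle t T tT TT) mulmxK//.
  by have := uM t; rewrite /M clamp_id.
- by move=> i j; exact: continuous_measurable_fun.
have bd i j : exists c, forall t, `|psi t i j| <= c.
  have cabs : {within `[0, T], continuous (fun t => `|psi t i j|)}.
    by apply: continuous_subspaceT => t; apply: cvg_norm; exact: cpsi.
  have [x _ xmax] := EVT_max T0 cabs.
  exists `|psi x i j| => t.
  have <- : psi (clamp t) i j = psi t i j.
    by rewrite /psi /M (clamp_id (clamp t))// in_itv/=.
  by apply: xmax; rewrite in_itv/=.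
have /choice[c cP] : forall ij : 'I_n * 'I_n,
    exists c, forall t, `|psi t ij.1 ij.2| <= c.
  by move=> ij; exact: bd.
exists (\big[Num.max/0]_ij c ij) => i j t.
by apply: le_trans (cP (i, j) t) _; exact: le_bigmax.
Qed.

(** Component [k] of the operator pairs [u] with row [k] of [Phi(T, .) B], whose
    entries are sums of bounded measurable multiples of entries of [B]. *)
Lemma control_op_representers (R : realType) (T : R) (n m : nat)
    (A : R -> 'M[R]_n) (B : R -> 'M[R]_(n, m)) (Phi : R -> R -> 'M[R]_n) :
  0 <= T -> Lp +oo%E T A -> Lp 2%:E T B -> transition_matrix T A Phi ->
  exists g : 'I_n -> R -> 'cV[R]_m, (forall k, Lp 2%:E T (g k)) /\
    forall u k, control_op T Phi B u k 0 = L2dot T u (g k).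
Proof.
move=> T0 Aoo B2 tPhi.
have [psi [PhiE mpsi [c bpsi]]] := transition_matrix_bounded_measurable T0 Aoo tPhi.
exists (fun k t => (row k (psi t *m B t))^T); split.
  move=> k i j.
  have -> : (fun t => (row k (psi t *m B t))^T i j) =
      (fun t => \sum_l psi t k l * B t l i).
    by apply/funext => t; rewrite !mxE.
  have -> : (fun t => \sum_l psi t k l * B t l i) \_ `[0, T] =
      \sum_l ((fun t => psi t k l * B t l i) \_ `[0, T]).
    apply/funext => t; rewrite fct_sumE patchE; case: ifPn => tT.
      by apply: eq_bigr => l _; rewrite patchE tT.
    by rewrite big1// => l _; rewrite patchE (negbTE tT).
  elim/big_ind: _ => [|f h f2 h2|l _].
  - exact: (Lfun_addr_closed lebesgue_measure (lee1n 2)).1.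
  - exact: (Lfun_addr_closed lebesgue_measure (lee1n 2)).2.
  - exact: (Lfun2_bounded_mul (mpsi k l) (bpsi k l) (B2 l i)).
move=> u k; rewrite mxE; apply: eq_Rintegral => t; rewrite inE/= => tT.
rewrite PhiE// dotvE mxE; apply: eq_bigr => i _.
by rewrite [in RHS]mxE [in RHS]mxE mulrC.
Qed.

(** * Convergence to the minimum-energy control *)

Theorem theorem5 (R : realType) (T : R) (hT : 0 < T)
  (n m N : nat)
  (K : set R) (hK : compact K)
  (beta : 'I_N -> R) (hbeta : forall i, K (beta i))
  (A : R -> R -> 'M[R]_n) (B : R -> R -> 'M[R]_(n, m))
  (hA : forall i, Lp +oo%E T (fun t => A t (beta i)))
  (hB : forall i, Lp 2%:E T (fun t => B t (beta i)))
  (Phi : R -> R -> R -> 'M[R]_n)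
  (hPhi : forall i, transition_matrix T (fun t => A t (beta i))
                      (fun t s => Phi t s (beta i)))
  (X0 XF : R -> 'cV[R]_n)
  (L : 'I_N -> (R -> 'cV[R]_m) -> 'cV[R]_n)
  (hL : forall i, L i = control_op T (fun t s => Phi t s (beta i))
                          (fun t => B t (beta i)))
  (Ls : 'I_N -> 'cV[R]_n -> R -> 'cV[R]_m)
  (hLs : forall i, Ls i = adjoint T (L i))
  (Winv : 'I_N -> 'cV[R]_n -> 'cV[R]_n)
  (hWinv : forall i, Winv i = inv_map (fun x => L i (Ls i x)))
  (xi : 'I_N -> 'cV[R]_n)
  (hxi : forall i, xi i = XF (beta i) - Phi T 0 (beta i) *m X0 (beta i))
  (hctrl : forall i, controllable T (L i))
  (C : 'I_N -> set (R -> 'cV[R]_m))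
  (hC : forall i, C i = steering_set T (L i) (xi i))
  (lambda : 'I_N -> R)
  (hlambda : forall i, 0 < lambda i /\ lambda i < 1)
  (hsum : \sum_(i < N) lambda i = 1)
  (hne : \bigcap_i C i !=set0)
  (u : nat -> R -> 'cV[R]_m)
  (hu : forall k, Lp 2%:E T (u k))
  (hu0 : u 0%N = 0 %[ae lebesgue_measure in `[0, T]%classic])
  (huS : forall k,
     u k.+1 = (u k - \sum_(i < N) lambda i *: Ls i (Winv i (L i (u k))))
              + \sum_(i < N) lambda i *: Ls i (Winv i (xi i))
     %[ae lebesgue_measure in `[0, T]%classic]) :
  exists us : R -> 'cV[R]_m,
    [/\ is_min_energy T (\bigcap_i C i) us,
        forall v, is_min_energy T (\bigcap_i C i) v ->
          v = us %[ae lebesgue_measure in `[0, T]%classic]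
      & L2norm T (u k - us) @[k --> \oo] --> 0].
Proof.
have /choice[g gP] : forall i, exists g : 'I_n -> R -> 'cV[R]_m,
    (forall k, Lp 2%:E T (g k)) /\
    forall v k, L i v k 0 = L2dot T v (g k).
  move=> i; rewrite hL.
  exact: (control_op_representers (ltW hT) (hA i) (hB i) (hPhi i)).
have LsE : Ls = fun i => adjoint T (L i) by apply/funext.
have CE : C = fun i => steering_set T (L i) (xi i) by apply/funext.
have WE : Winv = fun i => inv_map (fun x => L i (adjoint T (L i) x)).
  by apply/funext => i; rewrite hWinv LsE.
rewrite {}CE {}WE {}LsE in hne huS *.
apply: (steering_iteration_converges _ _ hctrl _ hsum hne hu hu0 huS).
- by move=> i; have [] := gP i.
- by move=> i v k _; have [_] := gP i; exact.
- by move=> i; have [] := hlambda i.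
Qed.
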